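(* Let $G$ be one of the consolidated Tait graphs $G_B^*$, $G_W^*$ of an oriented non-split alternating link, with $n$ vertices, weighted adjacency matrix $\overline A$ and ordinary ($0/1$) adjacency matrix $A=A(G)$, let $\det(\lambda I-A)=\lambda^n+c_1\lambda^{n-1}+\cdots+c_n$, and let $q\ge1$ be an integer with $2q+1\le n$. If the components corresponding to $G$ of $CWR_3,CWR_5,\ldots,CWR_{2q-1}$ all vanish (a vacuous condition when $q=1$), then $$\left.C_{2q+1}(\overline A)\right|_{w=r=1}=-\frac12c_{2q+1}.$$ Equivalently, when $2q+1$ is the length of the shortest odd cycle of $G$, the number of such shortest odd cycles is $-c_{2q+1}/2$.
   Context: Tait graphs and $CWR$. Let $D$ be a reduced (no nugatory crossings) alternating diagram of an oriented non-split alternating link $L$. The regions of $D$ are checkerboard coloured black and white, so that regions sharing an edge have opposite colours; which class is called black is fixed once and for all by a local rule depending on the over/under pattern at crossings, the same rule for all diagrams (the statement holds for either choice of rule). The Tait graph $G_B$ has one vertex for each black region and one edge for each crossing, joining the black regions meeting at that crossing; $G_W$ is defined in the same way from white regions. Each edge $e$ gets weight $\operatorname{wg}(e)=w$ if the crossing is positive and $r$ if it is negative, where $w,r$ are commuting indeterminates. The consolidated Tait graph $G_B^*$ is the weighted simple graph obtained from $G_B$ by replacing all parallel edges joining the same pair of vertices by a single edge whose weight is the product of their weights (so every edge weight is a monomial in $w,r$); $G_W^*$ is obtained from $G_W$ likewise. For $i>2$, $CB_i(w,r)=\sum_C\prod_{e\in E(C)}\operatorname{wg}(e)$, summed over all unoriented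 simple cycles $C$ of length $i$ in $G_B^*$ (zero if there are none); $CW_i$ is defined analogously from $G_W^*$; and $CWR_i=(CB_i,CW_i)$. The component of $CWR_i$ corresponding to $G$ is $CB_i$ if $G=G_B^*$ and $CW_i$ if $G=G_W^*$. The weighted adjacency matrix $\overline A$ has $(i,j)$ entry equal to the weight of the edge $v_iv_j$ if it exists, and $0$ otherwise. $C_k(\overline A)$ is the total weight of the unoriented simple $k$-cycles of $G$, the weight of a cycle being the product of its edge weights (so $C_k(\overline A)$ is the component of $CWR_k$ corresponding to $G$). *)

(* Defs.v *)
From HB Require Import structures.
From mathcomp Require Import all_boot all_fingroup all_algebra.
From mathcomp Require Import mpoly.

Set Implicit Arguments.
Unset Strict Implicit.
Unset Printing Implicit Defensive.

Import GRing.Theory.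
Local Open Scope ring_scope.

(** A connected oriented link diagram on the sphere with at least one crossing,
    as a combinatorial map.  A dart is a half-edge leaving a crossing; [turn]
    turns it counterclockwise to the next half-edge at the same crossing, and
    [flip] exchanges the two halves of an edge.  [over d]: the half-edge [d]
    belongs to the upper strand.  [out d]: the orientation of the link leaves
    the crossing along [d]; [out_turn] and [out_flip] say that the orientation
    goes straight through crossings and along edges.  Every diagram of a
    non-split link is connected; the crossingless diagram of the unknot, whose
    Tait graphs are single vertices, is not represented. *)
Record link_diagram := LinkDiagram {
  dart : finType;
  turn : {perm dart};
  flip : {perm dart};
  over : pred dart;
  out : pred dart;
  turn_card : forall d, #|porbit turn d| = 4;
  flip_card : forall d, #|porbit flip d| = 2;
  over_turn : forall d, over (turn d) = ~~ over d;
  out_turn : forall d, out (turn (turn d)) = ~~ out d;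
  out_flip : forall d, out (flip d) = ~~ out d;
  diagram_connected :
    forall d d', connect (fun a b => (b == turn a) || (b == flip a)) d d';
  diagram_planar :
    (#|porbits turn| + #|porbits (flip * turn^-1)%g| = #|porbits flip| + 2)%N
}.

Section Diagram.
Variable D : link_diagram.

Definition crossings : {set {set dart D}} := porbits (turn D).

(** The orbit of [d] under [flip] followed by [turn^-1] lists the boundary of the
    region lying to the left of [d], which has a corner between [d] and
    [turn d]. *)
Definition region (d : dart D) : {set dart D} :=
  porbit (flip D * (turn D)^-1)%g d.

Definition alternating : bool := [forall d : dart D, over (flip D d) == ~~ over d].

(** A crossing is nugatory when two of its opposite corners lie in the same
    region, i.e. when a circle on the sphere meets the diagram transversely in
    that crossing only. *)
Definition nugatory (c : {set dart D}) : bool :=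
  [exists d in c, region d == region (turn D (turn D d))].

Definition reduced : bool := [forall c in crossings, ~~ nugatory c].

(** Right-handed rule: a counterclockwise turn of less than a straight angle
    takes the direction of the upper strand to that of the lower one. *)
Definition positive (c : {set dart D}) : bool :=
  [exists d in c, [&& over d, out d & out (turn D d)]].

(** Local colouring rule for alternating diagrams: the regions swept when the
    upper strand is turned counterclockwise are black ([true]), the others are
    white ([false]). *)
Definition regions (b : bool) : {set {set dart D}} :=
  [set region d | d in [pred d | over d == b]].

Lemma over_region (d d' : dart D) :
  alternating -> d' \in region d -> over d' = over d.
Proof.
move=> /forallP alt; have step x : over ((flip D * (turn D)^-1)%g x) = over x.
  by apply/negb_inj; rewrite -over_turn permM permKV (eqP (alt x)).
case/porbitP=> i ->; elim: i => [|i IH]; first by rewrite expg0 perm1.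
by rewrite expgSr permM step.
Qed.

Lemma region_colour (d : dart D) (b : bool) :
  alternating -> (region d \in regions b) = (over d == b).
Proof.
move=> alt; apply/imsetP/idP => [[d' /eqP <- e]|od]; last by exists d.
by apply/eqP/(over_region alt); rewrite -e porbit_id.
Qed.

Lemma checkerboard (d : dart D) (b : bool) : alternating ->
  (region d \in regions b) = (region (flip D d) \in regions (~~ b)).
Proof.
move=> alt; rewrite !region_colour // (eqP (forallP alt d)).
by case: (over d) b => [] [].
Qed.

End Diagram.

(** Finite weighted multigraphs and weighted simple graphs.  In a simple graph
    an edge is identified with the set of its two end vertices. *)
Record wmultigraph (R : Type) := WMultigraph {
  mvertex : finType;
  mvertices : {set mvertex};
  medge : finType;
  medges : {set medge};
  mends : medge -> {set mvertex};
  mweight : medge -> R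
}.

Record wgraph (R : Type) := WGraph {
  vertex : finType;
  vertices : {set vertex};
  edges : {set {set vertex}};
  weight : {set vertex} -> R
}.

Definition consolidate (R : comNzRingType) (M : wmultigraph R) : wgraph R :=
  WGraph (mvertices M) [set mends c | c in medges M]
    (fun e => \prod_(c in medges M | mends c == e) mweight c).

Section WeightedGraph.
Variables (R : comNzRingType) (G : wgraph R).

Definition nvert : nat := #|vertices G|.

Definition vtx (i : 'I_nvert) : vertex G := enum_val i.

Definition adj : rel (vertex G) := fun x y => [set x; y] \in edges G.

Definition adj_mx : 'M[int]_nvert := \matrix_(i, j) (adj (vtx i) (vtx j))%:R.

Definition wadj_mx : 'M[R]_nvert :=
  \matrix_(i, j)
    (if adj (vtx i) (vtx j) then weight [set vtx i; vtx j] else 0).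

(** Unoriented simple cycles of length [k > 2], each given by its edge set. *)
Definition cycles (k : nat) : {set {set {set vertex G}}} :=
  [set C | (2 < k)%N &&
    [exists p : k.-tuple (vertex G),
       ucycleb adj p && (C == [set [set x; next p x] | x in p])]].

Definition cycle_poly (k : nat) : R :=
  \sum_(C in cycles k) \prod_(e in C) weight e.

(** [C_k(M)]: the total weight of the simple [k]-cycles of [G], the weight of
    an edge being read off from the symmetric matrix [M]. *)
Definition cycle_total (k : nat) (M : 'M[R]_nvert) : R :=
  \sum_(C in cycles k)
    \prod_(i < nvert) \prod_(j < nvert | (i < j)%N &&
                                         ([set vtx i; vtx j] \in C)) M i j.

(** The coefficient [c_k] of [X^(n - k)] in the characteristic polynomial of
    the 0/1 adjacency matrix. *)
Definition char_coef (k : nat) : int := (char_poly adj_mx)`_(nvert - k).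

Definition shortest_odd_cycle_length (m : nat) : Prop :=
  [/\ odd m, cycles m != set0 &
      forall k, odd k -> (k < m)%N -> cycles k = set0].

End WeightedGraph.

Definition wvar : {mpoly int[2]} := 'X_ord0.
Definition rvar : {mpoly int[2]} := 'X_ord_max.

Section Tait.
Variable D : link_diagram.

(** The Tait graph [G_B] for [b = true], [G_W] for [b = false]. *)
Definition tait (b : bool) : wmultigraph {mpoly int[2]} :=
  WMultigraph (regions D b) (crossings D)
    (fun c => [set region d | d in [pred d in c | over d == b]])
    (fun c => if positive c then wvar else rvar).

Definition ctait (b : bool) : wgraph {mpoly int[2]} := consolidate (tait b).

(** A reduced alternating diagram has loopless Tait graphs, so that [ctait b]
    is a simple graph. *)
Lemma ctait_simple (b : bool) (e : {set vertex (ctait b)}) :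
  reduced D -> e \in edges (ctait b) -> #|e| = 2.
Proof.
move=> red /imsetP[c cD ->].
have [d0 dc] : exists d0, d0 \in c.
  by case/imsetP: cD => d0 _ ->; exists d0; rewrite porbit_id.
have orb d : d \in c -> porbit (turn D) d = c.
  by case/imsetP: cD => d1 _ -> h; apply/eqP; rewrite eq_porbit_mem.
have tc d : d \in c -> turn D d \in c.
  by move=> dc'; rewrite -(orb _ dc') -{1}(expg1 (turn D)) mem_porbit.
have [d [{}dc ob]] : exists d, d \in c /\ over d == b.
  have [h|h] := boolP (over d0 == b); first by exists d0.
  exists (turn D d0); rewrite tc // over_turn; split=> //; move: h.
  by have: forall x y, x != y -> ~~ x == y by [case=> [] []]; apply.
have neq : region d != region (turn D (turn D d)).
  have /existsPn/(_ d) := forall_inP red c cD.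
  by rewrite dc.
suff -> : mends (w := tait b) c = [set region d; region (turn D (turn D d))].
  by rewrite cards2 neq.
apply/setP => r; rewrite !inE; apply/imsetP/orP => [[x]|].
  rewrite inE /= => /andP[xc ox] ->.
  move: (xc); rewrite -{1}(orb _ dc) porbit_traject turn_card !inE.
  case/or4P => /eqP ex; rewrite {}ex ?over_turn -?(eqP ob) in ox *.
  - by left.
  - by case: (over d) ox.
  - by right.
  - by case: (over d) ox.
case=> /eqP ->; [exists d | exists (turn D (turn D d))] => //.
  by rewrite inE /= dc.
by rewrite inE /= !tc //= !over_turn negbK.
Qed.

Definition CB (i : nat) : {mpoly int[2]} := cycle_poly (ctait true) i.
Definition CW (i : nat) : {mpoly int[2]} := cycle_poly (ctait false) i.
Definition CWR (i : nat) : {mpoly int[2]} * {mpoly int[2]} := (CB i, CW i).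

Definition CWR_component (b : bool) (i : nat) : {mpoly int[2]} :=
  if b then (CWR i).1 else (CWR i).2.

End Tait.

(* Main.v *)
(** Since the adjacency matrix has zero diagonal, the coefficient [c_m] is the
    signed sum over the permutations of the vertices that move exactly [m]
    vertices, each along an edge.  Let [m] be odd.  Such a permutation has an odd
    nontrivial cycle, which is an odd cycle of the graph; if the graph has no odd
    cycle shorter than [m], this cycle is all of the support, and the
    permutation is even.  Every simple [m]-cycle of the graph comes from exactly
    two such permutations, a cyclic permutation and its inverse, so [c_m] is
    minus twice the number of [m]-cycles.  At [w = r = 1] every monomial weight
    becomes 1: the vanishing of [CWR_k] thus excludes [k]-cycles, and
    [C_m] becomes the number of [m]-cycles. *)

Require Import Defs.
From mathcomp Require Import all_boot all_fingroup all_algebra.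
From mathcomp Require Import mpoly.

Set Implicit Arguments.
Unset Strict Implicit.
Unset Printing Implicit Defensive.

Import GRing.Theory.
Local Open Scope ring_scope.

(** * Orbits, signs and undirected arcs of permutations *)

Section Permutations.
Variable T : finType.
Implicit Types (s t : {perm T}) (x y : T).

Definition moved s : {set T} := [set x | s x != x].

Lemma moved_perm s x : (s x \in moved s) = (x \in moved s).
Proof. by rewrite !inE (inj_eq perm_inj). Qed.

Lemma porbit_moved s x y : y \in porbit s x -> (y \in moved s) = (x \in moved s).
Proof.
case/porbitP=> i ->; elim: i => [|i IH]; first by rewrite expg0 perm1.
by rewrite expgSr permM moved_perm.
Qed.

(** The moved points are partitioned into orbits, so even orbits alone would give an even total. *)
Lemma odd_moved_porbit s :
  odd #|moved s| -> exists2 x, x \in moved s & odd #|porbit s x|.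
Proof.
move=> om; apply/exists_inP; apply: contraLR om; rewrite negb_exists_in.
move/forall_inP=> even_orbits.
rewrite -sum1_card (partition_big_imset (porbit s)) /=.
elim/big_ind: _ => // [m n|_ /imsetP[x mx ->]].
  by rewrite oddD => /negbTE-> /negbTE->.
rewrite sum1dep_card.
suff -> : [set y in moved s | porbit s y == porbit s x] = porbit s x.
  exact: even_orbits.
apply/setP=> y; rewrite inE eq_porbit_mem andb_idl // => yx.
by rewrite (porbit_moved yx).
Qed.

Lemma odd_permX s n : odd_perm (s ^+ n)%g = odd n && odd_perm s.
Proof.
elim: n => [|n IH]; first by rewrite expg0 odd_perm1.
by rewrite expgS odd_permM IH /=; case: (odd n) (odd_perm s) => [] [].
Qed.

(** Raising [s] to the odd power [#|porbit s x|] gives the identity, and an odd power has the same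
    sign as [s]. *)
Lemma odd_cycle_even s x :
  odd #|porbit s x| -> moved s \subset porbit s x -> odd_perm s = false.
Proof.
move=> odd_orbit /subsetP mx.
suff /(congr1 (@odd_perm T)) : (s ^+ #|porbit s x|)%g = 1%g.
  by rewrite odd_permX odd_orbit odd_perm1.
apply/permP=> y; rewrite permX perm1.
have [/mx yx | /[!inE]/negPn/eqP sy] := boolP (y \in moved s); last exact: iter_fix.
have /eqP <- : porbit s y == porbit s x by rewrite eq_porbit_mem.
exact: iter_porbit.
Qed.

Lemma porbit_square_neq s x y :
  (2 < #|porbit s x|)%N -> y \in porbit s x -> s (s y) != y.
Proof.
move=> lt2; rewrite -eq_porbit_mem => /eqP yx; rewrite -{}yx in lt2.
apply: contraTneq lt2 => ssy; rewrite -leqNgt.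
suff /subset_leq_card le : porbit s y \subset [set y; s y].
  by apply: leq_trans le _; rewrite cards2; case: (_ != _).
apply/subsetP=> _ /porbitP[i ->].
elim: i => [|i]; first by rewrite expg0 perm1 set21.
by rewrite expgSr permM !inE => /orP[] /eqP ->; rewrite ?ssy eqxx ?orbT.
Qed.

(** The third hypothesis says that [s] and [t] trace the same undirected edges. Once [t] agrees with
    [s] on one arc, it is forced to go on around the cycle in the same direction. *)
Lemma cycle_eq_of_common_arc s t x :
    (2 < #|porbit s x|)%N -> moved s \subset porbit s x ->
    (forall y z, y != z -> (s y == z) || (s z == y) = (t y == z) || (t z == y)) ->
  t x = s x -> t = s.
Proof.
move=> lt2 /subsetP mx nbr tx.
have square y : y \in porbit s x -> s (s y) != y by exact: porbit_square_neq.
have agree i : t ((s ^+ i)%g x) = s ((s ^+ i)%g x).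
  elim: i => [|i IH]; first by rewrite expg0 perm1.
  rewrite expgSr permM; set y := (s ^+ i)%g x in IH *.
  have yx : y \in porbit s x by rewrite mem_porbit.
  have neq : s y != s (s y).
    by apply: contraNneq (square _ yx) => /perm_inj e; rewrite -!e.
  (* Either [t] follows [s] from [s y], or it sends [s (s y)] back to [s y], which is already [t y];
     injectivity then gives [s (s y) = y]. *)
  have := nbr _ _ neq; rewrite eqxx /= => /esym/orP[/eqP // | /eqP eq_y].
  have := square _ yx; suff -> : s (s y) = y by rewrite eqxx.
  by apply: (@perm_inj _ t); rewrite eq_y IH.
apply/permP=> y; have [/porbitP[i ->] // | ynx] := boolP (y \in porbit s x).
(* Off the orbit [s] fixes [y], so [y] has no incident edge and [t] cannot move it either. *)
have /eqP sy : s y == y by apply: contraR ynx => h; apply: mx; rewrite inE.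
rewrite sy; apply/eqP/negPn/negP => ty; rewrite eq_sym in ty.
have := nbr _ _ ty; rewrite eqxx sy (negbTE ty) /= => /eqP szy.
by case/eqP: ty; apply: (@perm_inj _ s); rewrite szy.
Qed.

Lemma cycle_eq_or_inverse s t x :
    (2 < #|porbit s x|)%N -> moved s \subset porbit s x ->
    (forall y z, y != z -> (s y == z) || (s z == y) = (t y == z) || (t z == y)) ->
  t = s \/ t = s^-1%g.
Proof.
move=> lt2 mx nbr.
have neq : x != s x.
  apply: contraNneq (porbit_square_neq lt2 (porbit_id s x)) => h.
  by rewrite -!h.
have := nbr _ _ neq; rewrite eqxx /= => /esym/orP[] /eqP tx.
  by left; apply: cycle_eq_of_common_arc lt2 mx nbr tx.
(* Here [t] runs through the arc backwards, so its inverse shares the arc with [s]. *)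
right; apply: invg_inj; rewrite invgK.
apply: cycle_eq_of_common_arc lt2 mx _ _ => [y z yz|].
  by rewrite nbr // !(can2_eq (permKV t) (permK t)) orbC ![_ == t _]eq_sym.
by rewrite -{1}tx permK.
Qed.

End Permutations.

(** In the Leibniz expansion of the determinant, each fixed point of [s] contributes exactly ['X]
    and each moved point a constant. The term of [s] is therefore a monomial of degree
    [n - #|moved s|]. *)
Lemma coef_char_poly_zero_diag (R : comNzRingType) (n m : nat) (A : 'M[R]_n) :
    (m <= n)%N -> (forall i, A i i = 0) ->
  (char_poly A)`_(n - m) =
    \sum_(s : 'S_n | #|moved s| == m)
      (-1) ^+ s * \prod_(i in moved s) - A i (s i).
Proof.
move=> mn A0; rewrite coef_sum [RHS]big_mkcond; apply: eq_bigr => s _ /=.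
rewrite (bigID (mem (moved s))) /=.
rewrite (eq_bigr (fun i => (- A i (s i))%:P)); last first.
  move=> i; rewrite inE eq_sym => /negbTE si; rewrite !mxE si mulr0n add0r.
  by rewrite polyCN.
rewrite [X in _ * (_ * X)](eq_bigr (fun=> 'X)); last first.
  by move=> i; rewrite inE negbK => /eqP si; rewrite !mxE si eqxx A0 polyC0 subr0.
rewrite -rmorph_prod prodr_const.
have -> : #|[predC moved s]| = (n - #|moved s|)%N.
  by have := cardC (moved s); rewrite card_ord => /(congr1 (subn^~ #|moved s|));
     rewrite addKn.
rewrite -(rmorph_sign polyC) mulrA -rmorphM coefCM coefXn.
(* Both bounds by [n] are needed to cancel the truncated subtractions. *)
have sn : (#|moved s| <= n)%N by have := max_card (moved s); rewrite card_ord.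
have -> : (n - m == n - #|moved s|)%N = (#|moved s| == m).
  by apply/eqP/eqP => [/(congr1 (subn n))|->//]; rewrite !subKn.
by case: eqP => _; rewrite ?mulr1 ?mulr0.
Qed.

(** * Permutations along edges and simple cycles of a graph *)

Section SimpleGraph.
Variables (R : comNzRingType) (G : wgraph R).
Hypothesis adj_irr : forall x : vertex G, ~~ adj x x.
Hypothesis adj_vertices : forall x y : vertex G, adj x y -> x \in vertices G.

Let V := vtx (G := G).
Implicit Types s t : 'S_(nvert G).

Lemma vtx_inj : injective V.
Proof. exact: enum_val_inj. Qed.

Lemma adj_sym (x y : vertex G) : adj x y = adj y x.
Proof. by rewrite /adj setUC. Qed.

Lemma vtx_surj x : x \in vertices G -> exists i, x = V i.
Proof. by move=> xG; exists (enum_rank_in xG x); rewrite /V /vtx enum_rankK_in. Qed.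

Definition moves_along_edges s := [forall x in moved s, adj (V x) (V (s x))].

(** These index the nonzero terms in the expansion of [char_coef G m]. *)
Definition edge_perms (m : nat) : {set 'S_(nvert G)} :=
  [set s | (#|moved s| == m) && moves_along_edges s].

Definition perm_edges s : {set {set vertex G}} :=
  [set [set V x; V (s x)] | x in moved s].

Lemma eq_vtx_pair x y z w :
  ([set V x; V y] == [set V z; V w]) =
    (x == z) && (y == w) || (x == w) && (y == z).
Proof.
apply/eqP/idP => [e|/orP[]/andP[/eqP-> /eqP->] //]; last by rewrite setUC.
have mem u : (u == x) || (u == y) = (u == z) || (u == w).
  by have /setP/(_ (V u)) := e; rewrite !inE !(inj_eq vtx_inj).
have := mem x; have := mem y; have := mem z; have := mem w.
rewrite !eqxx ?orbT /= ![z == _]eq_sym ![w == _]eq_sym.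
by case: (x == z) (x == w) (y == z) (y == w) => [] [] [] [].
Qed.

Lemma mem_perm_edges s x y :
  ([set V x; V y] \in perm_edges s) = (x != y) && ((s x == y) || (s y == x)).
Proof.
apply/imsetP/andP => [[z]|[neq]].
  rewrite inE => sz /eqP; rewrite eq_vtx_pair => /orP[] /andP[/eqP-> /eqP->].
    by rewrite eq_sym sz eqxx.
  by rewrite sz eqxx orbT.
case/orP=> /eqP e; [exists x | exists y]; rewrite ?inE ?e // 1?eq_sym //.
by rewrite setUC.
Qed.

Lemma perm_edgesV s : perm_edges s^-1 = perm_edges s.
Proof.
apply/setP=> e; apply/imsetP/imsetP=> -[x mx ->].
  exists (s^-1 x)%g; last by rewrite permKV setUC.
  rewrite -moved_perm permKV; move: mx.
  by rewrite !inE (can2_eq (permKV s) (permK s)) eq_sym.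
exists (s x); last by rewrite permK setUC.
by move: mx; rewrite !inE permK eq_sym.
Qed.

Lemma moves_along_edgesV s : moves_along_edges s^-1 = moves_along_edges s.
Proof.
suff imp t : moves_along_edges t -> moves_along_edges t^-1.
  by apply/idP/idP => /imp //; rewrite invgK.
move/forall_inP=> h; apply/forall_inP=> x.
rewrite inE (can2_eq (permKV t) (permK t)) eq_sym => tx.
rewrite adj_sym -{2}(permKV t x); apply: h.
by rewrite -moved_perm permKV inE.
Qed.

Lemma movedV s : moved s^-1 = moved s.
Proof.
by apply/setP=> x; rewrite !inE (can2_eq (permKV s) (permK s)) eq_sym.
Qed.

Lemma porbit_cycle s x :
    (2 < #|porbit s x|)%N ->
    (forall y, y \in porbit s x -> adj (V y) (V (s y))) ->
  [set [set V y; V (s y)] | y in porbit s x] \in cycles G #|porbit s x|.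
Proof.
move=> lt2 adjs; rewrite inE lt2 /=; set k := #|porbit s x| in lt2 *.
pose p := traject s x k.
have size_p : size (map V p) == k by rewrite size_map size_traject.
have p_orbit y : (y \in p) = (y \in porbit s x) by rewrite porbit_traject.
have uniq_p : uniq p by apply: uniq_traject_porbit.
have cycle_p : fcycle s p.
  have := iter_porbit s x; rewrite /p -/k; case: (k) lt2 => // k' _ loop.
  rewrite /= -[X in rcons _ X]loop iterSr -trajectSr; exact: fpath_traject.
have next_p y : y \in p -> next p y = s y.
  by move=> yp; apply/esym/eqP/(next_cycle cycle_p).
apply/existsP; exists (Tuple size_p); apply/andP; split.
  rewrite /ucycleb /= map_inj_uniq ?uniq_p ?andbT; last exact: vtx_inj.
  rewrite cycle_map; apply: (sub_in_cycle (P := mem p) (e := frel s)) cycle_p.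
    by move=> y z yp _ /= /eqP <-; apply: adjs; rewrite -p_orbit.
  by apply/allP.
apply/eqP/setP=> e; apply/imsetP/imsetP=> -[y] /=.
  rewrite -p_orbit => yp ->; exists (V y); first exact: map_f.
  by rewrite (next_map vtx_inj) // next_p.
case/mapP=> z zp -> ->; exists z; first by rewrite -p_orbit.
by rewrite (next_map vtx_inj) // next_p.
Qed.

(** The permutation is [next] on the cyclic sequence, which fixes every index outside it. *)
Lemma cycle_perm k C : C \in cycles G k ->
  exists2 s, s \in edge_perms k & perm_edges s = C.
Proof.
rewrite inE => /andP[_ /existsP[p /andP[]]].
rewrite /ucycleb => /andP[cycle_p uniq_p] /eqP ->.
(* Permutations act on matrix indices, so the cycle is lifted from vertices to indices; adjacency
   puts each of its points in [vertices G]. *)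
have [p' ep] : exists p', tval p = map V p'.
  have : all (mem (vertices G)) p.
    by apply/allP=> x xp; apply: adj_vertices (next_cycle cycle_p xp).
  elim: (tval p) => [|x r IH] /=; first by exists [::].
  by case/andP=> /vtx_surj[i ->] /IH[r' ->]; exists (i :: r').
rewrite ep in cycle_p uniq_p; rewrite map_inj_uniq in uniq_p; last exact: vtx_inj.
pose s := perm (can_inj (prev_next uniq_p)).
have next_p y : next p (V y) = V (s y) by rewrite permE ep (next_map vtx_inj).
have sedge y : y \in p' -> adj (V y) (V (s y)).
  by move=> yp; rewrite -next_p ep; apply: next_cycle => //; apply: map_f.
have moved_s y : (y \in moved s) = (y \in p').
  rewrite inE; apply/idP/idP => [|yp].
    by apply: contraR => yp; rewrite permE next_nth (negbTE yp).
  by apply: contraTneq (sedge y yp) => ->.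
exists s.
  rewrite inE; apply/andP; split.
    rewrite (eq_card moved_s) (card_uniqP uniq_p) -(size_map V) -ep.
    by rewrite size_tuple.
  by apply/forall_inP=> y; rewrite moved_s; apply: sedge.
apply/setP=> e; apply/imsetP/imsetP=> -[y].
  rewrite moved_s => yp ->; exists (V y); last by rewrite next_p.
  by rewrite -[_ \in _]/(_ \in tval p) ep map_f.
rewrite -[_ \in _]/(_ \in tval p) ep => /mapP[z zp ->] ->.
exists z; first by rewrite moved_s.
by rewrite -ep next_p.
Qed.

(** * Odd length with no shorter odd cycle *)

Section ShortestOddCycle.
Variable m : nat.
Hypothesis odd_m : odd m.
Hypothesis no_shorter : forall k, odd k -> (k < m)%N -> cycles G k = set0.

(** Some orbit of moved points is odd, hence of length at least 3, hence a simple odd cycle of the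
    graph. If it missed a moved point it would be shorter than [m]. *)
Lemma edge_perm_porbit s : s \in edge_perms m ->
  exists x, moved s = porbit s x /\ (2 < #|porbit s x|)%N.
Proof.
rewrite inE => /andP[/eqP card_s /forall_inP sedge].
have [|x mx odd_x] := @odd_moved_porbit _ s; first by rewrite card_s.
have sub : porbit s x \subset moved s by apply/subsetP=> y /porbit_moved ->.
have lt2 : (2 < #|porbit s x|)%N.
  have : (1 < #|porbit s x|)%N.
    have <- : #|[set x; s x]| = 2%N by rewrite cards2 eq_sym; move: mx; rewrite inE => ->.
    apply/subset_leq_card/subsetP=> y /set2P[] ->; first exact: porbit_id.
    by rewrite -{1}[s]expg1 mem_porbit.
  by case: #|_| odd_x => [|[|[]]].
exists x; split=> //; apply/esym/eqP; rewrite eqEcard sub /= leqNgt.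
apply/negP => lt_m; rewrite card_s in lt_m.
have /(porbit_cycle lt2) : forall y, y \in porbit s x -> adj (V y) (V (s y)).
  by move=> y /(subsetP sub); apply: sedge.
by rewrite no_shorter // in_set0.
Qed.

Lemma edge_perms_even s : s \in edge_perms m -> odd_perm s = false.
Proof.
move=> sP; have [x [ms _]] := edge_perm_porbit sP.
apply: (@odd_cycle_even _ s x); rewrite -ms //.
by move: sP; rewrite inE => /andP[/eqP ->].
Qed.

Lemma perm_edges_edge_perms : perm_edges @: edge_perms m = cycles G m.
Proof.
apply/setP=> C; apply/imsetP/idP => [[s sP ->]|/cycle_perm[s sP <-]]; last by exists s.
have [x [ms lt2]] := edge_perm_porbit sP.
move: sP; rewrite inE => /andP[/eqP <- /forall_inP sedge].
by rewrite /perm_edges ms; apply: porbit_cycle => // y; rewrite -ms; apply: sedge.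
Qed.

Lemma edge_perm_fibre s : s \in edge_perms m ->
  [set t in edge_perms m | perm_edges t == perm_edges s] = [set s; s^-1]%g.
Proof.
move=> sP; have [x [ms lt2]] := edge_perm_porbit sP.
apply/setP=> t; apply/setIdP/set2P => [[_ /eqP est]|]; last first.
  case=> ->; split; rewrite ?perm_edgesV //.
  by move: sP; rewrite !inE movedV moves_along_edgesV.
apply: (@cycle_eq_or_inverse _ s t x) => //; first by rewrite ms.
move=> y z neq; have /setP/(_ [set V y; V z]) := est.
by rewrite !mem_perm_edges neq.
Qed.

(** Each fibre of [perm_edges] is a permutation with its inverse, and these differ because the cycle
    is longer than 2. *)
Lemma card_edge_perms : #|edge_perms m| = (2 * #|cycles G m|)%N.
Proof.
rewrite -perm_edges_edge_perms -sum1_card (partition_big_imset perm_edges) /=.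
rewrite mulnC -sum_nat_const; apply: eq_bigr => _ /imsetP[s sP ->].
rewrite sum1dep_card edge_perm_fibre // cards2.
have [x [_ lt2]] := edge_perm_porbit sP.
suff -> : s != s^-1%g by [].
apply: contraNneq (porbit_square_neq lt2 (porbit_id s x)) => e.
by rewrite {1}e permK.
Qed.

Lemma char_coef_shortest : (m <= nvert G)%N ->
  char_coef G m = - (2 * #|cycles G m|)%:R.
Proof.
move=> mn; rewrite /char_coef coef_char_poly_zero_diag //; last first.
  by move=> i; rewrite mxE (negbTE (adj_irr _)).
rewrite -card_edge_perms -sum1_card natr_sum -sumrN.
(* A permutation with an arc off the graph has a zero factor; each remaining one is even and
   contributes [(-1) ^+ m = -1]. *)
rewrite (bigID moves_along_edges) /= [X in _ + X]big1 ?addr0; last first.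
  move=> s /andP[_ /forall_inPn[x mx nadj]].
  by rewrite (bigD1 x) //= mxE (negbTE nadj) oppr0 mul0r mulr0.
apply: eq_big => [s|s]; first by rewrite inE.
case/andP=> /eqP cs sedge; rewrite edge_perms_even ?inE ?cs ?eqxx //.
rewrite expr0 mul1r (eq_bigr (fun=> -1)) => [|x mx].
  by rewrite prodr_const cs -signr_odd odd_m.
by rewrite mxE (forall_inP sedge).
Qed.

End ShortestOddCycle.
End SimpleGraph.

Lemma cycle_edges_sub (R : comNzRingType) (G : wgraph R) (k : nat) C e :
  C \in cycles G k -> e \in C -> e \in edges G.
Proof.
rewrite inE => /andP[_ /existsP[p /andP[/andP[cycle_p _] /eqP ->]]].
by case/imsetP=> x xp ->; apply: (next_cycle cycle_p xp).
Qed.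

(** * Consolidated Tait graphs at w = r = 1 *)

Section TaitGraph.
Variables (D : link_diagram) (b : bool).
Let G := ctait D b.

Lemma meval1_weight e : (weight (w := G) e).@[fun=> 1] = 1.
Proof.
rewrite /= rmorph_prod big1 // => c _.
by case: ifP => _; rewrite /= mevalXU.
Qed.

Lemma meval1_cycle_poly k : (cycle_poly G k).@[fun=> 1] = #|cycles G k|%:R.
Proof.
rewrite /cycle_poly rmorph_sum -sum1_card natr_sum; apply: eq_bigr => C _.
by rewrite rmorph_prod big1 // => e _; apply: meval1_weight.
Qed.

(** Edges of a cycle are edges of [G], so the default entry 0 of [wadj_mx] is never read and every
    factor evaluates to 1. *)
Lemma meval1_cycle_total k :
  (cycle_total k (wadj_mx G)).@[fun=> 1] = #|cycles G k|%:R.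
Proof.
rewrite /cycle_total rmorph_sum -sum1_card natr_sum; apply: eq_bigr => C Ck.
rewrite rmorph_prod big1 // => i _; rewrite rmorph_prod big1 // => j /andP[_ eC].
by rewrite mxE /adj (cycle_edges_sub Ck eC); apply: meval1_weight.
Qed.

Lemma ctait_adj_irr : reduced D -> forall x : vertex G, ~~ adj x x.
Proof.
by move=> red x; apply/negP => /(ctait_simple red); rewrite setUid cards1.
Qed.

Lemma ctait_adj_vertices (x y : vertex G) : adj x y -> x \in vertices G.
Proof.
case/imsetP=> c _ /setP/(_ x); rewrite set21 => /esym/imsetP[d].
by rewrite inE => /andP[_ od] ->; apply: imset_f.
Qed.

End TaitGraph.

Lemma cycles_small (R : comNzRingType) (G : wgraph R) k :
  (k <= 2)%N -> cycles G k = set0.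
Proof. by move=> k2; apply/setP=> C; rewrite !inE ltnNge k2. Qed.

Unset Implicit Arguments.

Theorem corollary7p2 (D : link_diagram) (b : bool) (q : nat)
    (D_alternating : alternating D) (D_reduced : reduced D)
    (q_ge1 : (1 <= q)%N) (q_le : (2 * q + 1 <= nvert (ctait D b))%N) :
  let G := ctait D b in
  ((forall j : nat, (1 <= j < q)%N -> CWR_component D b (2 * j + 1) = 0) ->
   ((cycle_total (2 * q + 1) (wadj_mx G)).@[fun=> 1])%:~R
     = - (1 / 2%:R) * (char_coef G (2 * q + 1))%:~R :> rat)
  /\
  (shortest_odd_cycle_length G (2 * q + 1) ->
   #|cycles G (2 * q + 1)|%:R
     = - (1 / 2%:R) * (char_coef G (2 * q + 1))%:~R :> rat).
Proof.
move=> G; set m := (2 * q + 1)%N in q_le *.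
have odd_m : odd m by rewrite /m addn1 mul2n /= odd_double.
(* Both claims reduce to this count; only the source of the absence of shorter odd cycles
   differs. *)
have count : (forall k, odd k -> (k < m)%N -> cycles G k = set0) ->
    #|cycles G m|%:R = - (1 / 2%:R) * (char_coef G m)%:~R :> rat.
  move=> no_shorter; rewrite (char_coef_shortest _ _ odd_m no_shorter q_le).
  - rewrite rmorphN /= mulrNN natrM rmorphM /= mulrA mul1r mulVf // mul1r.
    by rewrite !rmorph_nat.
  - exact: ctait_adj_irr.
  - exact: ctait_adj_vertices.
split=> [CWR0 | [_ _]]; last exact: count.
rewrite meval1_cycle_total rmorph_nat; apply: count => k odd_k lt_km.
have [k2|k2] := leqP k 2; first exact: cycles_small.
have ek : k = (2 * k./2 + 1)%N by rewrite addn1 mul2n -{1}(odd_double_half k) odd_k.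
have := CWR0 k./2; rewrite -ek.
have -> : (1 <= k./2 < q)%N.
  by move: k2 lt_km; rewrite {1 2}ek /m !addn1 !ltnS ltn_pmul2l // => + ->; case: (k./2).
move=> /(_ isT) poly0; apply/eqP; rewrite -cards_eq0.
(* At 1 the vanishing polynomial becomes the number of [k]-cycles, an integer, so no cancellation
   can hide a cycle. *)
have : (cycle_poly G k).@[fun=> 1] = 0.
  move: poly0; rewrite /CWR_component /CWR /CB /CW /G.
  by case: (b) => /= ->; rewrite meval0.
by rewrite meval1_cycle_poly => /eqP; rewrite Num.Theory.pnatr_eq0.
Qed.
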